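(* Let $G=(V,E,w)$ be a weighted simple undirected graph with Laplacian $\boldsymbol{L}$ and boundary matrix $\boldsymbol{B}$, such that $W=\sum_{e\in E}w_e\geqslant\sigma_{\max}^2(\boldsymbol{B})/48$, and let $\epsilon\in(0,1)$. Then the $CR$ spectral sparsifier algorithm produces a multiplicative $\varepsilon$-spectral sparsifier $\tilde{G}$ of $G$, for $\varepsilon=\kappa_2(\boldsymbol{L})\cdot\epsilon$, with high probability for $r$ sufficiently large. That is, for every $\delta\in(0,1)$ there is $r_0$ (depending on $G,\epsilon,\delta$) such that for every integer $r\geqslant r_0$ the random Laplacian $\tilde{\boldsymbol{L}}$ output by the algorithm on input $(G,r)$ satisfies $$\Pr\Big[\ \big\|\boldsymbol{L}^{-1/2}(\boldsymbol{L}-\tilde{\boldsymbol{L}})\boldsymbol{L}^{-1/2}\big\|_2\leqslant\kappa_2(\boldsymbol{L})\cdot\epsilon\ \Big]\geqslant 1-\delta .$$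
   Context: $G=(V,E,w)$ is a finite weighted simple undirected graph with nonempty edge set $E$ and weights $w_e>0$ for $e\in E$. Fix an arbitrary orientation of each edge. For $e=(u,v)\in E$ let $\chi_e=\boldsymbol{e}_u-\boldsymbol{e}_v\in\mathbb{R}^V$ be the incidence vector ($\boldsymbol{e}_i$ the standard basis vectors) and $\tilde{\chi}_e=\sqrt{w_e}\,\chi_e$ the weighted incidence vector. The Laplacian of $G$ is $\boldsymbol{L}=\sum_{e\in E}w_e\,\chi_e\chi_e^T=\boldsymbol{B}^T\boldsymbol{B}\in\mathbb{R}^{V\times V}$, where the boundary matrix $\boldsymbol{B}\in\mathbb{R}^{E\times V}$ is the matrix with rows $\tilde{\chi}_e^T$ (up to sign). $\sigma_{\max}(\cdot)$ is the largest singular value and $\|\cdot\|_2$ the spectral norm; $\sigma_{\max}(\boldsymbol{L})=\sigma_{\max}^2(\boldsymbol{B})$. $\boldsymbol{L}^{\dagger}$ is the Moore–Penrose pseudoinverse and $\boldsymbol{L}^{-1/2}:=\sqrt{\boldsymbol{L}^{\dagger}}$ (positive semidefinite square root). The condition number is $\kappa_2(\boldsymbol{L})=\|\boldsymbol{L}\|_2\|\boldsymbol{L}^{\dagger}\|_2$; it equals $\sigma_{\max}(\boldsymbol{L})/\sigma_{\min}(\boldsymbol{L})$ where $\sigma_{\min}(\boldsymbol{L})=1/\|\boldsymbol{L}^{\dagger}\|_2$, which for connected $G$ is the second smallest singular value of $\boldsymbol{L}$. $CR$ spectral sparsifier algorithm. Input: $G=(V,E,w)$ and the number $r$ of sampling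 trials. Put $W=\sum_{e\in E}w_e$ and $p_e=w_e/W$. Start with $\tilde{\boldsymbol{L}}=\boldsymbol{0}$; for $i=1,\dots,r$, sample an edge $e'\in E$ independently, with replacement, according to $\{p_e\}_{e\in E}$, and update $\tilde{\boldsymbol{L}}\gets\tilde{\boldsymbol{L}}+\frac{W}{rw_{e'}}\tilde{\chi}_{e'}\tilde{\chi}_{e'}^T=\tilde{\boldsymbol{L}}+\frac{W}{r}\chi_{e'}\chi_{e'}^T$. Output: $\tilde{\boldsymbol{L}}$, which is the Laplacian of the sketched graph $\tilde{G}=(V,\tilde{E},\tilde{w})$ whose edges are the sampled edges, each receiving weight $\frac{W}{r}$ times the number of times it was sampled. Multiplicative $\varepsilon$-spectral sparsifier ($\varepsilon>0$): a graph $\tilde{G}$ on $V$ with Laplacian $\tilde{\boldsymbol{L}}$ is a multiplicative $\varepsilon$-spectral sparsifier of $G$ if $\|\boldsymbol{L}^{-1/2}(\boldsymbol{L}-\tilde{\boldsymbol{L}})\boldsymbol{L}^{-1/2}\|_2\leqslant\varepsilon$. *)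

(* Defs.v *)
From mathcomp Require Import all_boot all_order all_algebra.
From mathcomp Require Import complex boolp classical_sets reals.

Set Implicit Arguments.
Unset Strict Implicit.
Unset Printing Implicit Defensive.

Import Order.TTheory GRing.Theory Num.Theory.
Local Open Scope ring_scope.

Section MatrixNotions.
Variable R : realType.

Definition l2norm n (x : 'cV[R]_n) : R := Num.sqrt (\sum_i x i 0 ^+ 2).

(* The norm induced by the Euclidean norm; the matrix norm `|A| of
   MathComp-Analysis is the entrywise maximum. *)
Definition spectral_norm m n (A : 'M[R]_(m, n)) : R :=
  sup [set l2norm (A *m x) | x in [set x : 'cV[R]_n | l2norm x <= 1]]%classic.

Definition singular_value m n (A : 'M[R]_(m, n)) (s : R) : Prop :=
  0 <= s /\ eigenvalue (A^T *m A) (s ^+ 2).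

Definition sigma_max m n (A : 'M[R]_(m, n)) : R :=
  sup [set s | singular_value A s]%classic.

(* The four Penrose equations. *)
Definition is_mp_pinv m n (A : 'M[R]_(m, n)) (X : 'M[R]_(n, m)) : Prop :=
  [/\ A *m X *m A = A, X *m A *m X = X,
      (A *m X)^T = A *m X & (X *m A)^T = X *m A].

(* Not pinvmx, which is only a partial inverse on the row space. *)
Definition mp_pinv m n (A : 'M[R]_(m, n)) : 'M[R]_(n, m) :=
  xget 0 [set X | is_mp_pinv A X]%classic.

Definition psd n (A : 'M[R]_n) : Prop :=
  A^T = A /\ forall x : 'cV[R]_n, 0 <= (x^T *m A *m x) 0 0.

Definition is_psd_sqrt n (A S : 'M[R]_n) : Prop := psd S /\ S *m S = A.

Definition psd_sqrt n (A : 'M[R]_n) : 'M[R]_n :=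
  xget 0 [set S | is_psd_sqrt A S]%classic.

Definition mx_inv_sqrt n (A : 'M[R]_n) : 'M[R]_n := psd_sqrt (mp_pinv A).

Definition kappa2 n (A : 'M[R]_n) : R :=
  spectral_norm A * spectral_norm (mp_pinv A).

Lemma mulmx_tr_ge0 n (x : 'cV[R]_n) : 0 <= (x^T *m x) 0 0.
Proof. by rewrite mxE sumr_ge0 // => i _; rewrite mxE -expr2 sqr_ge0. Qed.

Lemma mulmx_tr_eq0 m n (A : 'M[R]_(m, n)) : A^T *m A = 0 -> A = 0.
Proof.
move=> /matrixP AA; apply/matrixP => i j; apply/eqP.
move: (AA j j); rewrite !mxE => /eqP; rewrite psumr_eq0 => [|k _].
  by move/allP => /(_ i); rewrite mem_index_enum mxE -expr2 sqrf_eq0; exact.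
by rewrite mxE -expr2 sqr_ge0.
Qed.

Lemma gram_unit m n (A : 'M[R]_(m, n)) : row_free A -> A *m A^T \in unitmx.
Proof.
rewrite -!kermx_eq0 => /eqP kA; rewrite -row_free_unit -kermx_eq0.
set K := kermx _; have: K *m A = 0.
  apply: trmx_inj; rewrite trmx0; apply: mulmx_tr_eq0.
  by rewrite trmxK trmx_mul mulmxA -(mulmxA K) mulmx_ker mul0mx.
by move/eqP; rewrite -sub_kermx kA submx0.
Qed.

Lemma mp_pinvP m n (A : 'M[R]_(m, n)) : is_mp_pinv A (mp_pinv A).
Proof.
rewrite /mp_pinv; case: xgetP => // /(_ _) noX; exfalso.
have [k [C [B [AE BB CC]]]] : exists k (C : 'M_(m, k)) (B : 'M_(k, n)),
    [/\ A = C *m B, B *m B^T \in unitmx & C^T *m C \in unitmx].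
  exists (\rank A), (col_base A), (row_base A); split.
  - by rewrite mulmx_base.
  - by rewrite gram_unit // row_base_free.
  rewrite -{2}[col_base A]trmxK gram_unit // /row_free mxrank_tr.
  exact: col_base_full.
apply: (noX (B^T *m invmx (B *m B^T) *m invmx (C^T *m C) *m C^T)).
have AX : A *m (B^T *m invmx (B *m B^T) *m invmx (C^T *m C) *m C^T) =
    C *m invmx (C^T *m C) *m C^T.
  rewrite AE !mulmxA; congr (_ *m _ *m _).
  by rewrite -(mulmxA C) -(mulmxA C) mulmxV // mulmx1.
have XA : B^T *m invmx (B *m B^T) *m invmx (C^T *m C) *m C^T *m A =
    B^T *m invmx (B *m B^T) *m B.
  rewrite AE !mulmxA; congr (_ *m _).
  by rewrite -!mulmxA mulVmx // mulmx1.
split=> /=.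
- by rewrite AX AE -!mulmxA (mulmxA C^T) mulKmx.
- by rewrite XA -!mulmxA (mulmxA B) mulKVmx.
- by rewrite AX !trmx_mul trmxK trmx_inv trmx_mul trmxK mulmxA.
- by rewrite XA !trmx_mul trmxK trmx_inv trmx_mul trmxK mulmxA.
Qed.

Lemma mp_pinv_unique m n (A : 'M[R]_(m, n)) X Y :
  is_mp_pinv A X -> is_mp_pinv A Y -> X = Y.
Proof.
move=> [AXA XAX AXt XAt] [AYA YAY AYt YAt].
have e1 : A *m X = A *m Y.
  rewrite -[LHS]AXt -{1}AYA -(mulmxA _ A) trmx_mul AXt AYt.
  by rewrite mulmxA AXA.
have e2 : X *m A = Y *m A.
  rewrite -[LHS]XAt -{1}AYA -mulmxA mulmxA trmx_mul YAt XAt.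
  by rewrite -mulmxA (mulmxA A) AXA.
by rewrite -XAX -mulmxA e1 mulmxA e2.
Qed.

Lemma interpolation (s : seq R) (g : R -> R) :
  exists q : {poly R}, {in s, forall x, q.[x] = g x}.
Proof.
elim: s => [|y s [q qP]]; first by exists 0.
have [ys|ys] := boolP (y \in s).
  by exists q => x; rewrite inE => /predU1P[->|]; exact: qP.
pose p := \prod_(z <- s) ('X - z%:P).
have py : p.[y] != 0 by rewrite -/(root _ _) root_prod_XsubC.
exists (q + ((g y - q.[y]) / p.[y]) *: p) => x; rewrite inE !hornerE.
have [->|_ /= xs] := eqVneq x y; first by rewrite divfK // subrKC.
have /rootP -> : root p x by rewrite root_prod_XsubC.
by rewrite mulr0 addr0 qP.
Qed.

(* A fourth root that is a polynomial in A: its square is a square root of A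
   that commutes with all the others, whence existence and uniqueness. *)
Lemma psd_root4 n (A : 'M[R]_n.+1) : psd A ->
  exists2 q, (horner_mx A q)^T = horner_mx A q & horner_mx A q ^+ 4 = A.
Proof.
move=> [At Ap]; pose f := real_complex R; pose M := map_mx f A.
have Mh : M \is hermsymmx.
  apply: realsym_hermsym.
    by apply/is_hermitianmxP; rewrite expr0 scale1r map_mx_id // map_trmx At.
  by apply/mxOverP => i j; rewrite mxE; apply/complex_realP; exists (A i j).
have dr := hermitian_spectral_diag_real Mh.
have Pu := spectral_unit M.
have /hermitian_normalmx /orthomx_spectralP ME := Mh.
move: dr Pu ME; set P := spectralmx M; set d := spectral_diag M => dr Pu ME.
pose l i := complex.Re (d 0 i).
have dl i : d 0 i = f (l i) by rewrite /f /l RRe_real // (mxOverP dr).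
have l0 i : 0 <= l i.
  have /eigenvalueP[x /eqP xA x0] : eigenvalue A (l i).
    rewrite -(eigenvalue_map f); apply/eigenvalueP; exists (row i P).
      rewrite -/M ME -row_mul !mulmxA mulmxV // mul1mx mul_diag_mx.
      by apply/rowP => j; rewrite !mxE dl.
    apply: contraTneq Pu => ri; rewrite -row_free_unit; apply/negP => fP.
    have /(row_free_inj fP)/matrixP/(_ 0 i) :
      delta_mx 0 i *m P = (0 : 'rV_n.+1) *m P by rewrite -rowE ri mul0mx.
    by rewrite !mxE !eqxx => /eqP; rewrite oner_eq0.
  have := Ap x^T; rewrite trmxK (eqP xA) -scalemxAl mxE.
  rewrite pmulr_lge0 // lt_def; have := mulmx_tr_ge0 x^T; rewrite trmxK => ->.
  rewrite andbT; apply: contra x0 => /eqP xx; rewrite -trmx_eq0.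
  apply/eqP/mulmx_tr_eq0; rewrite trmxK; apply/matrixP => a b.
  by rewrite !ord1 xx mxE.
have [q qP] := interpolation [seq l i | i : 'I_n.+1]
  (fun x => Num.sqrt (Num.sqrt x)).
exists q.
  have trX k : (A ^+ k)^T = A ^+ k.
    elim: k => [|k IH]; first by rewrite expr0 trmx1.
    by rewrite [RHS]exprSr exprS trmx_mul IH At.
  rewrite -[q]coefK poly_def rmorph_sum /= raddf_sum; apply: eq_bigr => i _.
  by rewrite linearZ rmorphXn /= horner_mx_X linearZ /= trX.
apply: (map_mx_inj (f := f)).
rewrite -rmorphXn /= map_horner_mx -/M ME.
rewrite horner_mx_uconjC // horner_mx_diag; congr (_ *m _ *m _).
congr diag_mx; apply/rowP => i; rewrite mxE dl rmorphXn /= horner_exp.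
rewrite horner_map qP ?map_f ?mem_enum // -rmorphXn.
by rewrite (exprM _ 2 2) !sqr_sqrtr ?sqrtr_ge0.
Qed.

Lemma psd_sqrtP n (A : 'M[R]_n) : psd A -> is_psd_sqrt A (psd_sqrt A).
Proof.
rewrite /psd_sqrt => pA; case: xgetP => // /(_ _) noS; exfalso.
case: n => [|n] in A pA noS *.
  by apply: (noS A); split=> //; rewrite [LHS]flatmx0 [RHS]flatmx0.
have [q] := psd_root4 pA; set T := horner_mx A q => Tt TA.
apply: (noS (T *m T)); split; last by rewrite -[RHS]TA !exprS mulr1 -!mulmxE !mulmxA.
split=> [|x]; first by rewrite trmx_mul Tt.
by have := mulmx_tr_ge0 (T *m x); rewrite trmx_mul Tt !mulmxA.
Qed.

Lemma psd_ker n (A : 'M[R]_n) (x : 'cV[R]_n) :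
  psd A -> (x^T *m A *m x) 0 0 = 0 -> A *m x = 0.
Proof.
move=> /psd_sqrtP; set S := psd_sqrt A => -[[St _] <-] xx.
suff Sx : S *m x = 0 by rewrite -mulmxA Sx mulmx0.
apply: mulmx_tr_eq0; apply/matrixP => a b.
by rewrite !ord1 trmx_mul St !mulmxA -(mulmxA x^T) xx mxE.
Qed.

Lemma psd_sqrt_unique n (A S1 S2 : 'M[R]_n) :
  psd A -> is_psd_sqrt A S1 -> is_psd_sqrt A S2 -> S1 = S2.
Proof.
case: n => [|n] in A S1 S2 *; first by rewrite [S1]flatmx0 [S2]flatmx0.
move=> pA; have [q] := psd_root4 pA; set T := horner_mx A q => Tt TA.
suff U S : is_psd_sqrt A S -> S = T *m T by move=> /U-> /U->.
move=> [[St Sp] SA].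
have Cm : comm_mx S T by apply: comm_mx_horner; rewrite /comm_mx -SA mulmxA.
pose S0 := T *m T; pose D := S - S0.
have pS0 : psd S0.
  split=> [|x]; first by rewrite trmx_mul Tt.
  by have := mulmx_tr_ge0 (T *m x); rewrite trmx_mul Tt !mulmxA.
have Dt : D^T = D by rewrite linearB /= St pS0.1.
have DS : D *m (S + S0) = 0.
  rewrite mulmxBl !mulmxDr SA; have -> : S0 *m S0 = A.
    by rewrite -TA !exprS mulr1 /S0 -!mulmxE !mulmxA.
  have -> : S *m S0 = S0 *m S by rewrite /S0 mulmxA Cm -mulmxA Cm mulmxA.
  by rewrite [A + _]addrC subrr.
suff Dx (x : 'cV_n.+1) : D *m x = 0.
  apply/eqP; rewrite -subr_eq0; apply/eqP/matrixP => i j.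
  by have /matrixP/(_ i 0) := Dx (delta_mx j 0); rewrite -colE !mxE.
pose y := D *m x; have : (y^T *m S *m y) 0 0 + (y^T *m S0 *m y) 0 0 = 0.
  have <- : (y^T *m (S + S0) *m y) 0 0 =
    (y^T *m S *m y) 0 0 + (y^T *m S0 *m y) 0 0.
    by rewrite mulmxDr mulmxDl mxE.
  by rewrite trmx_mul Dt -(mulmxA _ D) DS mulmx0 mul0mx mxE.
move=> /eqP; rewrite paddr_eq0 ?Sp ?pS0.2 // => /andP[/eqP yS /eqP yS0].
have Dy : D *m y = 0.
  by rewrite mulmxBl (psd_ker _ yS) ?(psd_ker pS0 yS0) ?subrr.
by apply: mulmx_tr_eq0; rewrite trmx_mul Dt -mulmxA Dy mulmx0.
Qed.

Lemma psd_mp_pinv n (A : 'M[R]_n) : psd A -> psd (mp_pinv A).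
Proof.
move=> [At Ap]; have := mp_pinvP A; set X := mp_pinv A => -[e1 e2 e3 e4].
have Xt : X^T = X.
  apply: (@mp_pinv_unique _ _ A) => //; split.
  - by apply: trmx_inj; rewrite !trmx_mul trmxK At mulmxA.
  - by apply: trmx_inj; rewrite !trmx_mul trmxK At mulmxA.
  - by rewrite trmx_mul trmxK At -{1}e4 trmx_mul At.
  - by rewrite trmx_mul trmxK At -{1}e3 trmx_mul At.
split=> // x; rewrite -e2; have := Ap (X *m x).
by rewrite trmx_mul Xt !mulmxA.
Qed.

End MatrixNotions.

(* Simple undirected graphs: an edge is an unordered pair of distinct vertices,
   and only the values of weight on the edges are meaningful. *)
Record wgraph (R : realType) (V : finType) := WGraph {
  edges : {set {set V}};
  weight : {set V} -> R;
  card_edge : {in edges, forall e : {set V}, #|e| = 2%N};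
  weight_gt0 : {in edges, forall e, 0 < weight e} }.

Section Graph.
Variables (R : realType) (V : finType) (G : wgraph R V).

Definition edge : finType := {e : {set V} | e \in edges G}.

Definition is_orientation (o : {set V} -> V * V) : Prop :=
  {in edges G, forall e, e = [set (o e).1; (o e).2]}.

Variable o : {set V} -> V * V.

Definition std_basis (v : V) : 'cV[R]_#|V| := delta_mx (enum_rank v) 0.

Definition incidence (e : {set V}) : 'cV[R]_#|V| :=
  std_basis (o e).1 - std_basis (o e).2.

Definition wincidence (e : {set V}) : 'cV[R]_#|V| :=
  Num.sqrt (weight G e) *: incidence e.

Definition laplacian : 'M[R]_#|V| :=
  \sum_(e in edges G) weight G e *: (incidence e *m (incidence e)^T).

Definition boundary_mx : 'M[R]_(#|edges G|, #|V|) :=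
  \matrix_i (wincidence (enum_val i))^T.

Definition total_weight : R := \sum_(e in edges G) weight G e.

Definition edge_prob (e : edge) : R := weight G (val e) / total_weight.

(* The law of r independent samples from edge_prob. *)
Definition sample_Pr (r : nat) (A : pred {ffun 'I_r -> edge}) : R :=
  \sum_(s | A s) \prod_(i < r) edge_prob (s i).

(* Output of the CR algorithm when the i-th trial samples the edge s i. *)
Definition cr_laplacian (r : nat) (s : {ffun 'I_r -> edge}) : 'M[R]_#|V| :=
  \sum_(i < r) (total_weight / (r%:R * weight G (val (s i)))) *:
    (wincidence (val (s i)) *m (wincidence (val (s i)))^T).

End Graph.

Definition spectral_sparsifier (R : realType) n (eps : R) (L Lt : 'M[R]_n) :
    bool :=
  spectral_norm (mx_inv_sqrt L *m (L - Lt) *m mx_inv_sqrt L) <= eps.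

Section Facts.
Variables (R : realType) (V : finType) (G : wgraph R V).
Variable o : {set V} -> V * V.

Lemma wincidenceM e : e \in edges G ->
  wincidence G o e *m (wincidence G o e)^T =
  weight G e *: (incidence R o e *m (incidence R o e)^T).
Proof.
move=> eG; rewrite /wincidence linearZ /= -scalemxAl -scalemxAr scalerA.
by rewrite -expr2 sqr_sqrtr // ltW // weight_gt0.
Qed.

Lemma laplacian_boundary :
  laplacian G o = (boundary_mx G o)^T *m boundary_mx G o.
Proof.
apply/matrixP => a b; rewrite summxE big_enum_val /= [RHS]mxE.
apply: eq_bigr => i _; rewrite -wincidenceM ?enum_valP //.
by rewrite !mxE big_ord1 !mxE.
Qed.

Lemma psd_laplacian : psd (laplacian G o).
Proof.
rewrite laplacian_boundary; split=> [|x]; first by rewrite trmx_mul trmxK.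
by have := mulmx_tr_ge0 (boundary_mx G o *m x); rewrite trmx_mul !mulmxA.
Qed.

Lemma total_weight_gt0 : edges G != finset.set0 -> 0 < total_weight G.
Proof.
case/set0Pn => e eG; rewrite /total_weight (bigD1 e) //=.
by rewrite ltr_wpDr ?weight_gt0 // sumr_ge0 // => f /andP[/weight_gt0/ltW].
Qed.

Lemma sample_PrT r : edges G != finset.set0 ->
  sample_Pr (fun _ : {ffun 'I_r -> edge G} => true) = 1.
Proof.
move=> E0; rewrite /sample_Pr.
rewrite -(bigA_distr_bigA (fun _ : 'I_r => @edge_prob R V G)) /=.
apply: big1 => i _; rewrite /edge_prob -mulr_suml.
have -> : \sum_(e : edge G) weight G (val e) = total_weight G.
  by rewrite /total_weight -big_sub.
by rewrite divff // gt_eqF // total_weight_gt0.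
Qed.

Section Sketch.
Variables (r : nat) (s : {ffun 'I_r -> edge G}).

Definition sketch_edges : {set {set V}} := [set val (s i) | i : 'I_r].

Definition sketch_weight (e : {set V}) : R :=
  total_weight G / r%:R * #|[set i | val (s i) == e]|%:R.

Lemma sketch_edgesS : {subset sketch_edges <= edges G}.
Proof. by move=> e /imsetP[i _ ->]; exact: valP. Qed.

Lemma sketch_card_edge : {in sketch_edges, forall e : {set V}, #|e| = 2%N}.
Proof. by move=> e /sketch_edgesS /card_edge. Qed.

Lemma sketch_weight_gt0 : {in sketch_edges, forall e, 0 < sketch_weight e}.
Proof.
move=> e /[dup] /sketch_edgesS eG /imsetP[i _ ei].
rewrite mulr_gt0 ?divr_gt0 ?ltr0n //.
- by apply: total_weight_gt0; apply/set0Pn; exists e.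
- exact: leq_ltn_trans (ltn_ord i).
- by apply/card_gt0P; exists i; rewrite inE ei.
Qed.

Definition sketch : wgraph R V := WGraph sketch_card_edge sketch_weight_gt0.

Lemma laplacian_sketch : laplacian sketch o = cr_laplacian o s.
Proof.
rewrite /laplacian /cr_laplacian /=.
rewrite [RHS](partition_big (fun i => val (s i)) (mem sketch_edges)) /=;
  last by move=> i _; exact: imset_f.
apply: eq_bigr => e es; have we := weight_gt0 (sketch_edgesS es).
rewrite (eq_bigr (fun _ => (total_weight G / r%:R) *:
  (incidence R o e *m (incidence R o e)^T))) => [|i /eqP ->].
  by rewrite sumr_const -scaler_nat scalerA mulrC /sketch_weight cardsE mulrC.
rewrite wincidenceM ?sketch_edgesS // scalerA; congr (_ *: _).
by rewrite invfM mulrA divfK // gt_eqF.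
Qed.

End Sketch.
End Facts.

(* Main.v *)
Require Import Defs.
From mathcomp Require Import all_boot all_order all_algebra.
From mathcomp Require Import reals.
From mathcomp Require Import boolp.
From mathcomp Require Import ring.

(** Writing [S] for [L^(-1/2)], the error [S (L - Lt) S] is the average of [r]
    independent copies of the centred random matrix
    [S (L - W chi_e chi_e^T) S]. The expectation of its squared
    Frobenius norm, which dominates the squared spectral norm, is therefore a
    constant over [r], and Chebyshev's inequality concludes, since
    [kappa2 L * eps > 0]. *)

Set Implicit Arguments.
Unset Strict Implicit.
Unset Printing Implicit Defensive.

Import Order.TTheory GRing.Theory Num.Theory.
Local Open Scope ring_scope.

(** * Spectral norm against Frobenius norm *)

Lemma sum_mul_sqr_le (R : realDomainType) (I : finType) (a b : I -> R) :
  (\sum_i a i * b i) ^+ 2 <= (\sum_i a i ^+ 2) * (\sum_i b i ^+ 2).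
Proof.
rewrite -subr_ge0 -(pmulrn_lge0 _ (n := 2)) //.
(* Lagrange's identity, doubled so that the squares range over all ordered pairs. *)
have -> : ((\sum_i a i ^+ 2) * (\sum_i b i ^+ 2) - (\sum_i a i * b i) ^+ 2) *+ 2
    = \sum_i \sum_j (a i * b j - a j * b i) ^+ 2.
  have prodE (f g : I -> R) :
      (\sum_i f i) * (\sum_i g i) = \sum_i \sum_j f i * g j.
    by rewrite mulr_suml; under eq_bigr do rewrite mulr_sumr.
  rewrite mulr2n {1}[_ * \sum_i b i ^+ 2]mulrC expr2 !prodE -!sumrB -big_split.
  apply: eq_bigr => i _; rewrite -!sumrB -big_split; apply: eq_bigr => j _ /=.
  ring.
by apply: sumr_ge0 => i _; apply: sumr_ge0 => j _; exact: sqr_ge0.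
Qed.

(** Kept without the square root, so that its expectation can be computed entry by entry. *)
Definition frob2 (R : realType) m n (A : 'M[R]_(m, n)) : R :=
  \sum_i \sum_j A i j ^+ 2.

Lemma frob2_ge0 (R : realType) m n (A : 'M[R]_(m, n)) : 0 <= frob2 A.
Proof. by apply: sumr_ge0 => i _; apply: sumr_ge0 => j _; exact: sqr_ge0. Qed.

Lemma frob2Z (R : realType) m n (a : R) (A : 'M[R]_(m, n)) :
  frob2 (a *: A) = a ^+ 2 * frob2 A.
Proof.
rewrite /frob2 mulr_sumr; apply: eq_bigr => i _; rewrite mulr_sumr.
by apply: eq_bigr => j _; rewrite mxE exprMn.
Qed.

(** Cauchy-Schwarz on each row of [A]; the factor coming from [x] is at most 1. *)
Lemma l2norm_mulmx_le (R : realType) m n (A : 'M[R]_(m, n)) (x : 'cV[R]_n) :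
  l2norm x <= 1 -> l2norm (A *m x) <= Num.sqrt (frob2 A).
Proof.
have x0 : 0 <= \sum_i x i 0 ^+ 2 by apply: sumr_ge0 => i _; exact: sqr_ge0.
rewrite /l2norm -[X in _ <= X]sqrtr1 ler_sqrt // => x1.
rewrite ler_sqrt ?frob2_ge0 // ler_sum // => i _.
rewrite mxE (le_trans (sum_mul_sqr_le _ _)) // ler_piMr // sumr_ge0 // => j _.
exact: sqr_ge0.
Qed.

Lemma l2norm0 (R : realType) n : l2norm (0 : 'cV[R]_n) = 0.
Proof. by rewrite /l2norm big1 ?sqrtr0 // => i _; rewrite mxE expr0n. Qed.

Lemma spectral_norm_le_frob (R : realType) m n (A : 'M[R]_(m, n)) :
  spectral_norm A <= Num.sqrt (frob2 A).
Proof.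
apply: ge_sup => [|_ [x /= x1 <-]]; last exact: l2norm_mulmx_le.
by exists (l2norm (A *m 0)), 0 => //=; rewrite l2norm0.
Qed.

(** The Frobenius bound makes the set bounded above, so that its [sup] is a genuine supremum and not
    a default value. *)
Lemma le_spectral_norm (R : realType) m n (A : 'M[R]_(m, n)) (x : 'cV[R]_n) :
  l2norm x <= 1 -> l2norm (A *m x) <= spectral_norm A.
Proof.
move=> x1; apply: ub_le_sup; last by exists x.
by exists (Num.sqrt (frob2 A)) => _ [y /= y1 <-]; exact: l2norm_mulmx_le.
Qed.

Lemma spectral_norm_gt0 (R : realType) m n (A : 'M[R]_(m, n)) :
  A != 0 -> 0 < spectral_norm A.
Proof.
move=> A0; have [i [j Aij]] : exists i j, A i j != 0.
  apply: contrapT => nA; case/eqP: A0; apply/matrixP => i j; rewrite mxE.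
  by apply/eqP/negPn/negP => Aij; apply: nA; exists i, j.
(* The test vector is the basis vector at [j]: its image is column [j], which contains the nonzero
   entry. *)
have d1 : l2norm (delta_mx j 0 : 'cV[R]_n) <= 1.
  rewrite /l2norm (bigD1 j) //= big1 => [|k /negPf kj].
    by rewrite mxE !eqxx expr1n addr0 sqrtr1.
  by rewrite mxE kj expr0n.
apply: lt_le_trans (le_spectral_norm A d1).
rewrite /l2norm sqrtr_gt0 -colE (bigD1 i) //= ltr_pwDl //.
  by rewrite mxE exprn_even_gt0.
by apply: sumr_ge0 => k _; exact: sqr_ge0.
Qed.

(** * Second moments of sums of independent samples *)

Section IndependentSamples.
Variables (R : realType) (T : finType) (p : T -> R).
Hypothesis p_sum1 : \sum_t p t = 1.

(** Once [f (s i)] is absorbed into the factor at [i], the sum over samples splits into a product of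
    sums over [T], each equal to 1 except at [i]. *)
Lemma sum_prod_apply (r : nat) (i : 'I_r) (f : T -> R) :
  \sum_(s : {ffun 'I_r -> T}) (\prod_k p (s k)) * f (s i) = \sum_t p t * f t.
Proof.
transitivity (\sum_(s : {ffun 'I_r -> T})
    \prod_k (p (s k) * if k == i then f (s k) else 1)).
  apply: eq_bigr => s _; rewrite big_split /=; congr (_ * _).
  by rewrite -big_mkcond big_pred1_eq.
rewrite -(bigA_distr_bigA (fun k t => p t * if k == i then f t else 1)) /=.
rewrite (bigD1 i) //= eqxx [X in _ * X]big1 ?mulr1 // => k /negPf ->.
by under eq_bigr do rewrite mulr1.
Qed.

Lemma sum_prod_apply2 (r : nat) (i j : 'I_r) (f g : T -> R) : i != j ->
  \sum_(s : {ffun 'I_r -> T}) (\prod_k p (s k)) * (f (s i) * g (s j)) =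
  (\sum_t p t * f t) * (\sum_t p t * g t).
Proof.
move=> ij; have ji : (j == i) = false by rewrite eq_sym (negPf ij).
pose h k t := p t * if k == i then f t else if k == j then g t else 1.
transitivity (\sum_(s : {ffun 'I_r -> T}) \prod_k h k (s k)).
  apply: eq_bigr => s _; rewrite big_split /=; congr (_ * _).
  rewrite (bigD1 i) //= eqxx (bigD1 j) /= ?ji // eqxx.
  by rewrite big1 ?mulr1 // => k /andP[/negPf -> /negPf ->].
rewrite -bigA_distr_bigA /= (bigD1 i) // (bigD1 j) /= ?ji // /h eqxx ji eqxx.
rewrite mulrA [X in _ * X]big1 ?mulr1 // => k /andP[/negPf -> /negPf ->].
by under eq_bigr do rewrite mulr1.
Qed.

(** Expanding the square, the off-diagonal terms factor by independence and vanish since [f] is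
    centred; the [r] diagonal terms are equal. *)
Lemma variance_sum (r : nat) (f : T -> R) : \sum_t p t * f t = 0 ->
  \sum_(s : {ffun 'I_r -> T}) (\prod_k p (s k)) * (\sum_i f (s i)) ^+ 2 =
  r%:R * \sum_t p t * f t ^+ 2.
Proof.
move=> f0.
transitivity (\sum_i \sum_j \sum_(s : {ffun 'I_r -> T})
    (\prod_k p (s k)) * (f (s i) * f (s j))).
  under [RHS]eq_bigr do rewrite exchange_big /=.
  rewrite [RHS]exchange_big /=; apply: eq_bigr => s _.
  rewrite expr2 mulr_suml mulr_sumr; apply: eq_bigr => i _.
  by rewrite !mulr_sumr.
rewrite -[r in RHS]card_ord -sum1_card natr_sum mulr_suml.
apply: eq_bigr => i _.
rewrite (bigD1 i) //= [X in _ + X]big1 ?addr0 => [|j ij].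
  under eq_bigr do rewrite -expr2.
  by rewrite (sum_prod_apply _ (fun t => f t ^+ 2)) mul1r.
by rewrite sum_prod_apply2 1?eq_sym // f0 mul0r.
Qed.

Lemma mx_variance_sum (r m n : nat) (X : T -> 'M[R]_(m, n)) :
  \sum_t p t *: X t = 0 ->
  \sum_(s : {ffun 'I_r -> T}) (\prod_k p (s k)) * frob2 (\sum_i X (s i)) =
  r%:R * \sum_t p t * frob2 (X t).
Proof.
move=> X0.
under eq_bigr do rewrite mulr_sumr.
under [in RHS]eq_bigr do rewrite mulr_sumr.
rewrite exchange_big [in RHS]exchange_big mulr_sumr; apply: eq_bigr => a _ /=.
under eq_bigr do rewrite mulr_sumr.
under [in RHS]eq_bigr do rewrite mulr_sumr.
rewrite exchange_big [in RHS]exchange_big mulr_sumr; apply: eq_bigr => b _ /=.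
under eq_bigr do rewrite summxE.
apply: (@variance_sum r (fun t => X t a b)); have /matrixP/(_ a b) := X0.
rewrite summxE [in RHS]mxE => X0ab; rewrite -[RHS]X0ab.
by apply: eq_bigr => t _; rewrite mxE.
Qed.

End IndependentSamples.

(** * The sampling law and the error of one trial *)

Section CRSampling.
Variables (R : realType) (V : finType) (G : wgraph R V) (o : {set V} -> V * V).
Hypothesis edges_neq0 : edges G != set0.

Lemma edge_prob_ge0 (e : edge G) : 0 <= edge_prob e.
Proof.
by rewrite divr_ge0 ?ltW ?total_weight_gt0 // weight_gt0 // (valP e).
Qed.

Lemma edge_prob_sum1 : \sum_(e : edge G) edge_prob e = 1.
Proof.
rewrite -mulr_suml.
have -> : \sum_(e : edge G) weight G (val e) = total_weight G.
  by rewrite /total_weight -big_sub.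
by rewrite divff // gt_eqF // total_weight_gt0.
Qed.

(** The total mass 1 splits over [A] and its complement; on the complement [Z / t] is at least 1, so
    that part weighs at most the mean of [Z / t]. *)
Lemma markov_sample_Pr (r : nat) (A : pred {ffun 'I_r -> edge G})
    (Z : {ffun 'I_r -> edge G} -> R) (t : R) : 0 < t -> (forall s, 0 <= Z s) ->
  (forall s, ~~ A s -> t <= Z s) ->
  1 - (\sum_(s : {ffun _}) (\prod_i edge_prob (s i)) * Z s) / t <= sample_Pr A.
Proof.
move=> t0 Z0 AZ.
have P0 (s : {ffun 'I_r -> edge G}) : 0 <= \prod_i edge_prob (s i).
  by apply: prodr_ge0 => i _; exact: edge_prob_ge0.
have := sample_PrT r edges_neq0; rewrite /sample_Pr (bigID A) /= => PT.
rewrite lerBlDr -[leLHS]PT lerD2l.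
rewrite ler_pdivlMr // mulr_suml [leRHS](bigID A) /= -[leLHS]add0r lerD //.
  by apply: sumr_ge0 => s _; rewrite mulr_ge0.
by apply: ler_sum => s /AZ; exact: ler_wpM2l.
Qed.

(** The deviation of a single trial, without the factor [1 / r]. *)
Definition edge_error (e : edge G) : 'M[R]_#|V| :=
  laplacian G o - (total_weight G / weight G (val e)) *:
    (wincidence G o (val e) *m (wincidence G o (val e))^T).

(** The probability of [e] cancels the scaling [W / w_e], so one trial is an unbiased estimator of
    the Laplacian. *)
Lemma edge_error_mean0 : \sum_e edge_prob e *: edge_error e = 0.
Proof.
under eq_bigr do rewrite scalerBr.
rewrite sumrB -scaler_suml edge_prob_sum1 scale1r /laplacian (big_sub).
apply/eqP; rewrite subr_eq0; apply/eqP/eq_bigr => e _.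
have w0 := weight_gt0 (valP e); rewrite -wincidenceM ?(valP e) // scalerA.
rewrite /edge_prob mulrA divfK ?divff ?scale1r // gt_eqF //.
exact: total_weight_gt0.
Qed.

Lemma laplacian_sub_cr (r : nat) (s : {ffun 'I_r -> edge G}) : (0 < r)%N ->
  laplacian G o - cr_laplacian o s = r%:R^-1 *: \sum_i edge_error (s i).
Proof.
move=> r0; rewrite sumrB sumr_const card_ord scalerBr -scaler_nat scalerA.
rewrite mulVf ?pnatr_eq0 -?lt0n // scale1r scaler_sumr; congr (_ - _).
by apply: eq_bigr => i _; rewrite scalerA invfM mulrCA.
Qed.

(** * Positivity of the error threshold *)

Lemma incidence_neq0 e : is_orientation G o -> e \in edges G ->
  incidence R o e != 0.
Proof.
move=> oP eG; have := card_edge eG; rewrite {1}(oP e eG) cards2.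
case: eqVneq => // uv _; apply: contraNneq uv.
move=> /matrixP/(_ (enum_rank (o e).1) 0).
rewrite !mxE !eqxx !andbT (inj_eq enum_rank_inj); case: eqP => // _ /eqP.
by rewrite subr0 oner_eq0.
Qed.

(** A vanishing Gram matrix forces the boundary matrix to vanish, but the row of any edge is
    nonzero. *)
Lemma laplacian_neq0 : is_orientation G o -> laplacian G o != 0.
Proof.
move=> oP; case/set0Pn: edges_neq0 => e eG.
apply/eqP; rewrite laplacian_boundary => /mulmx_tr_eq0 B0.
have /eqP : wincidence G o e = 0.
  have := congr1 (row (enum_rank_in eG e)) B0.
  rewrite rowK enum_rankK_in // row0 => /(congr1 trmx).
  by rewrite trmxK trmx0.
rewrite scaler_eq0 (negPf (incidence_neq0 oP eG)) orbF.
by rewrite sqrtr_eq0 leNgt weight_gt0.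
Qed.

End CRSampling.

(** By the Penrose equation [A X A = A], the pseudoinverse of a nonzero matrix is nonzero. *)
Lemma kappa2_gt0 (R : realType) n (A : 'M[R]_n) : A != 0 -> 0 < kappa2 A.
Proof.
move=> A0; rewrite mulr_gt0 ?spectral_norm_gt0 //.
have [AXA _ _ _] := mp_pinvP A; apply: contraNneq A0 => X0.
by rewrite -AXA X0 mulmx0 mul0mx.
Qed.

Theorem proposition2 (R : realType) (V : finType) (G : wgraph R V)
    (o : {set V} -> V * V) (eps : R)
    (edges_neq0 : edges G != set0)
    (o_orient : is_orientation G o)
    (W_large : sigma_max (boundary_mx G o) ^+ 2 / 48 <= total_weight G)
    (eps_gt0 : 0 < eps) (eps_lt1 : eps < 1) :
  forall delta : R, 0 < delta -> delta < 1 ->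
  exists r0 : nat, forall r : nat, (r0 <= r)%N ->
    1 - delta <=
      sample_Pr (fun s : {ffun 'I_r -> edge G} =>
        spectral_sparsifier (kappa2 (laplacian G o) * eps)
          (laplacian G o) (cr_laplacian o s)).
Proof.
move=> delta delta_gt0 _.
set L := laplacian G o; set S := mx_inv_sqrt L; set k := kappa2 L * eps.
have k0 : 0 < k by rewrite mulr_gt0 ?kappa2_gt0 ?laplacian_neq0.
pose X (e : edge G) := S *m edge_error o e *m S.
have X0 : \sum_e edge_prob e *: X e = 0.
  transitivity (S *m (\sum_(e : edge G) edge_prob e *: edge_error o e) *m S).
    rewrite mulmx_sumr mulmx_suml; apply: eq_bigr => e _.
    by rewrite -scalemxAr -scalemxAl.
  by rewrite edge_error_mean0 // mulmx0 mul0mx.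
pose C := \sum_e edge_prob e * frob2 (X e).
(* Chebyshev leaves a failure probability of at most [C / (r k^2)], which is at most [delta] from
   this bound on. The successor ensures [r > 0]. *)
exists (Num.bound (C / (delta * k ^+ 2))).+1 => r r0r.
have r0 : (0 < r)%N by exact: leq_trans r0r.
pose Z (s : {ffun 'I_r -> edge G}) := frob2 (r%:R^-1 *: \sum_i X (s i)).
have EZ : \sum_(s : {ffun _}) (\prod_i edge_prob (s i)) * Z s = C / r%:R.
  (* Averaging contributes [1 / r^2] and the [r] independent trials contribute [r C]. *)
  transitivity (r%:R^-1 ^+ 2 * \sum_(s : {ffun 'I_r -> edge G})
      (\prod_i edge_prob (s i)) * frob2 (\sum_i X (s i))).
    by rewrite mulr_sumr; apply: eq_bigr => s _; rewrite mulrCA -frob2Z.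
  rewrite mx_variance_sum ?edge_prob_sum1 // -/C mulrA.
  by rewrite expr2 mulfVK ?pnatr_eq0 -?lt0n // mulrC.
have := @markov_sample_Pr _ _ _ edges_neq0 r (fun s =>
  spectral_sparsifier k L (cr_laplacian o s)) Z (k ^+ 2).
rewrite EZ => Pr; apply: le_trans (Pr _ _ _).
- rewrite lerD2l lerN2 mulrAC ler_pdivrMr ?ltr0n //.
  rewrite [delta * _]mulrC -ler_pdivrMr // -mulrA -invfM [k ^+ 2 * _]mulrC.
  have /ltW/le_trans -> // : C / (delta * k ^+ 2) < r%:R.
  apply: lt_le_trans (archi_boundP _) _; last by rewrite ler_nat ltnW.
  rewrite divr_ge0 //; last by apply: mulr_ge0; [exact: ltW|exact: sqr_ge0].
  by apply: sumr_ge0 => e _; rewrite mulr_ge0 ?frob2_ge0 ?edge_prob_ge0.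
- by rewrite exprn_gt0.
- by move=> s; exact: frob2_ge0.
(* On a failing sample the spectral norm of the error exceeds [k], hence so does its Frobenius norm,
   and [Z s] is at least [k^2]. *)
move=> s; rewrite /spectral_sparsifier -ltNge laplacian_sub_cr // -/S => kN.
have ZE : S *m (r%:R^-1 *: \sum_i edge_error o (s i)) *m S =
    r%:R^-1 *: \sum_i X (s i).
  by rewrite -scalemxAr -scalemxAl mulmx_sumr mulmx_suml.
rewrite ZE in kN; have {}kN := lt_le_trans kN (spectral_norm_le_frob _).
rewrite -[leRHS]sqr_sqrtr ?frob2_ge0 // ler_sqr ?nnegrE ?sqrtr_ge0 ?(ltW k0) //.
exact: ltW.
Qed.
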